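(* Let $t,u$ be positive integers. Then there exist $\alpha=\alpha(t,u)>0$ and $\beta=\beta(u)>0$ (the latter depending only on $u$) such that for every positive integer $n$, $$R_{t,u}(n)\leq \alpha n^{\beta}.$$
   Context: A function $f:\mathbb{R}^{m}\to\mathbb{R}$ is linear if $f(\mathbf{x})=b+\sum_{i=1}^m a_i\mathbf{x}(i)$ for some reals $a_1,\dots,a_m,b$. A finite simple graph $G$ is semilinear* of complexity $(t,u)$ if $V(G)\subset\mathbb{R}^d$ for some positive integer $d$ and there are $tu$ linear functions $f_{i,j}:\mathbb{R}^d\times\mathbb{R}^d\to\mathbb{R}$, $(i,j)\in[u]\times[t]$, such that for distinct $\mathbf{x},\mathbf{y}\in V(G)$, $\{\mathbf{x},\mathbf{y}\}$ is an edge iff $\bigvee_{i\in[u]}\bigwedge_{j\in[t]}\{f_{i,j}(\mathbf{x},\mathbf{y})<0\}$ is true; it is assumed that this truth value is unchanged when $\mathbf{x}$ and $\mathbf{y}$ are swapped. $R_{t,u}(n)$ denotes the smallest $N$ such that every semilinear* graph of complexity $(t,u)$ on $N$ vertices contains a clique or an independent set of size $n$. *)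

(* Defs.v *)
From Stdlib Require Import Rdefinitions Raxioms Rpower.
From HB Require Import structures.
From mathcomp Require Import all_boot all_order all_algebra.
From mathcomp Require Import Rstruct.
Set Implicit Arguments. Unset Strict Implicit. Unset Printing Implicit Defensive.
Import Order.TTheory GRing.Theory Num.Theory.

Local Open Scope ring_scope.

Definition point (d : nat) := 'rV[R]_d.

Definition linfun2 (d : nat) := ((point d * point d) * R)%type.

Definition eval_lin (d : nat) (f : linfun2 d) (x y : point d) : R :=
  f.2 + \sum_(k < d) f.1.1 ord0 k * x ord0 k
      + \sum_(k < d) f.1.2 ord0 k * y ord0 k.

Definition sl_adj (d t u : nat) (F : 'I_u -> 'I_t -> linfun2 d)
    (x y : point d) : Prop :=
  exists i : 'I_u, forall j : 'I_t, eval_lin (F i j) x y < 0.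

Definition sl_symmetric (d t u : nat) (V : seq (point d))
    (F : 'I_u -> 'I_t -> linfun2 d) : Prop :=
  forall x y, x \in V -> y \in V -> x <> y -> (sl_adj F x y <-> sl_adj F y x).

Definition ramsey_prop (t u n N : nat) : Prop :=
  forall (d : nat), (0 < d)%N ->
  forall (V : seq (point d)), uniq V -> size V = N ->
  forall (F : 'I_u -> 'I_t -> linfun2 d), sl_symmetric V F ->
  exists S : seq (point d),
    [/\ uniq S, {subset S <= V}, size S = n &
      (forall x y, x \in S -> y \in S -> x <> y -> sl_adj F x y) \/
      (forall x y, x \in S -> y \in S -> x <> y -> ~ sl_adj F x y)].

(* R_{t,u}(n) <= z  iff  some N <= z has the Ramsey property (R_{t,u}(n)
   being the least such N). *)
Definition R_tu_le (t u n : nat) (z : R) : Prop :=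
  exists N : nat, Rle (INR N) z /\ ramsey_prop t u n N.

(* Main.v *)
(** A condition f(x, y) < 0 with f linear has the form g x < h y. When
    h x <= g x at all points, this relation is transitive; when g x < h x, it
    says that the interval of y is not entirely to the left of that of x, and
    splitting the intervals recursively at a median cuts N points into about
    log N classes on which it is transitive. So all tu relations are transitive
    on a subset of size N / (log N)^(tu), and there each of the u conjunctions
    is transitive too. Applying Mirsky's theorem to them one after another gives
    a clique of size n or divides the size by at most n^u, so
    N >= n^(u+1) (log N)^(tu) suffices; the exponent u + 2 absorbs the
    logarithms. *)
Require Import Defs.
From Stdlib Require Import Reals.
From mathcomp Require Import all_boot Rstruct.
From mathcomp Require Import all_order all_algebra zify ring.
Set Implicit Arguments. Unset Strict Implicit. Unset Printing Implicit Defensive.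
Import Order.TTheory GRing.Theory Num.Theory.

(** * Classes of points on which a relation [g x < h y] is transitive *)

Lemma pigeonhole_filter (T : eqType) (c : T -> nat) (k : nat) (V : seq T) :
  {in V, forall x, c x < k} ->
  exists i, size V <= k * size [seq x <- V | c x == i].
Proof.
elim: k V => [|k IH] V cV.
  by case: V cV => [|x V] cV; [exists 0 | have := cV x (mem_head _ _)].
have [|i Hi] := IH [seq x <- V | c x != k].
  by move=> x; rewrite mem_filter => /andP[/eqP ck /cV]; lia.
have szV : size V = size [seq x <- V | c x == k] + size [seq x <- V | c x != k].
  by rewrite !size_filter -(count_predC (fun x => c x == k) V).
have le_i : size [seq x <- [seq x <- V | c x != k] | c x == i]
          <= size [seq x <- V | c x == i].
  by rewrite -filter_predI !size_filter; apply: sub_count => x /= /andP[].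
have [ge|lt] := leqP (size [seq x <- V | c x == k]) (size [seq x <- V | c x == i]).
  by exists i; nia.
by exists k; nia.
Qed.

Section Coloring.
Context {disp : Order.disp_t} {D : orderType disp} {T : eqType}.
Implicit Types (g h : T -> D) (V : seq T).

(** [p] is the middle entry of the sorted values of [h]: smaller values occur only before it, larger
    ones only after it. *)
Lemma median_exists h V (m : nat) : V != [::] -> size V < 2 * m ->
  exists p, count (fun x => h x < p)%O V < m /\ count (fun x => p < h x)%O V < m.
Proof.
rewrite -size_eq0 -lt0n => V0 ltV.
have [v _] : exists v, v \in V by case: V V0 {ltV} => // v V _; exists v; rewrite mem_head.
have half_lt : (size V)./2 < size V by lia.
have half_ltm : (size V)./2 < m by lia.
have half_gem : size V - (size V)./2.+1 < m by lia.
pose s := sort <=%O (map h V).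
have szs : size s = size V by rewrite size_sort size_map.
pose i := (size V)./2; pose p := nth (h v) s i.
have lti : i < size s by rewrite szs.
have cnt (q : pred D) : count (fun x => q (h x)) V = count q s.
  by rewrite count_sort count_map; apply: eq_count.
have srt : sorted <=%O s by apply: sort_sorted; apply: le_total.
have mono a b : a <= b -> b < size s -> (nth (h v) s a <= nth (h v) s b)%O.
  move=> ab bs; apply: (sorted_leq_nth le_trans lexx _ srt) => //.
  by rewrite inE; apply: leq_ltn_trans bs.
exists p; rewrite (cnt (fun y => y < p)%O) (cnt (fun y => p < y)%O); split.
- rewrite -(cat_take_drop i s) count_cat.
  have -> : count (fun y => (y < p)%O) (drop i s) = 0.
    apply/eqP; rewrite eqn0Ngt -has_count; apply/hasPn => y /(nthP (h v))[j].
    rewrite size_drop nth_drop => ltj <-.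
    by rewrite -leNgt; apply: mono; rewrite ?leq_addr // -ltn_subRL.
  rewrite addn0; apply: leq_ltn_trans (count_size _ _) _.
  by rewrite size_takel // ltnW.
- rewrite -(cat_take_drop i.+1 s) count_cat.
  have -> : count (fun y => (p < y)%O) (take i.+1 s) = 0.
    apply/eqP; rewrite eqn0Ngt -has_count; apply/hasPn => y /(nthP (h v))[j].
    rewrite size_takel // => ltj <-; rewrite nth_take // -leNgt.
    by apply: mono => //; apply: ltnSE.
  rewrite add0n; apply: leq_ltn_trans (count_size _ _) _.
  by rewrite size_drop szs.
Qed.

(* Intervals containing the median right endpoint p get a new colour: the
   relation is total on them. The relation always holds from an interval left
   of p to one right of p, and never backwards, so the two sides can share the
   remaining colours. *)
Lemma interval_coloring g h (k : nat) V :
  size V < 2 ^ k -> {in V, forall x, (g x < h x)%O} ->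
  exists2 c : T -> nat, {in V, forall x, c x < k} &
    forall i, {in [seq x <- V | c x == i] & &,
                 transitive (fun x y => (g x < h y)%O)}.
Proof.
elim: k V => [|k IH] V ltV ghV.
  by exists (fun=> 0) => [x|i x]; case: V ltV {ghV} => //= y V; rewrite ltnS.
have [->|V0] := eqVneq V [::]; first by exists (fun=> 0).
have [p [ltL ltR]] : exists p, count (fun x => h x < p)%O V < 2 ^ k /\
                               count (fun x => p < h x)%O V < 2 ^ k.
  by apply: median_exists => //; rewrite -expnS.
have [||cL cLk cLtr] := IH [seq x <- V | (h x < p)%O].
- by rewrite size_filter.
- by move=> x; rewrite mem_filter => /andP[_ /ghV].
have [||cR cRk cRtr] := IH [seq x <- V | (p <= g x)%O].
- rewrite size_filter; apply: leq_ltn_trans ltR.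
  rewrite -!size_filter; set s := (X in size X <= _).
  (* An interval that starts at or after [p] ends strictly after [p], so [ltR] bounds their
     number. *)
  have -> : s = [seq x <- V | (p <= g x)%O && (p < h x)%O].
    apply: eq_in_filter => x xV; case: (leP p (g x)) => //= pg.
    by rewrite (le_lt_trans pg (ghV x xV)).
  by rewrite !size_filter; apply: sub_count => x /= /andP[].
- by move=> x; rewrite mem_filter => /andP[_ /ghV].
pose c x := if (h x < p)%O then cL x else if (p <= g x)%O then cR x else k.
exists c => [x xV|i y x z].
  rewrite /c; case: ifP => hx; last case: ifP => gx //.
    by apply: ltnW; apply: cLk; rewrite mem_filter hx.
  by apply: ltnW; apply: cRk; rewrite mem_filter gx.
have key w : w \in [seq x <- V | c x == i] ->
  [\/ w \in [seq x <- [seq x <- V | (h x < p)%O] | cL x == i]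
        /\ i < k /\ (g w < p)%O /\ (h w < p)%O,
      w \in [seq x <- [seq x <- V | (p <= g x)%O] | cR x == i]
        /\ i < k /\ (p <= g w)%O /\ (p <= h w)%O |
      i = k /\ (g w < p)%O /\ (p <= h w)%O].
  rewrite !mem_filter => /andP[/eqP cw wV]; move: cw; rewrite /c.
  have gh := ghV w wV.
  case: ltP => hw; last case: (leP p (g w)) => gw => e.
  - move=> e; constructor 1; rewrite e eqxx wV; split=> //; split.
      by rewrite -e; apply: cLk; rewrite mem_filter hw.
    by split=> //; apply: lt_trans hw.
  - constructor 2; rewrite e eqxx wV; split=> //; split=> //.
    by rewrite -e; apply: cRk; rewrite mem_filter gw.
  - by constructor 3.
move=> /key ky /key kx /key kz xy yz.
have no a b : (a < b)%O -> (p <= a)%O -> (b < p)%O -> False.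
  by move=> ab pa bp; have := lt_trans (le_lt_trans pa ab) bp; rewrite ltxx.
have nk : i < k -> i = k -> False by move=> /[swap] ->; rewrite ltnn.
(* If [g x < p <= h z], the conclusion is immediate. Otherwise [x] and [z] are on the same side of
   [p], or [x] is right and [z] left; a [y] not covered by induction is excluded by [no]. *)
case: kx => [[x1 [ik [gx hx]]]|[x1 [ik [gx hx]]]|[ik [gx hx]]];
case: kz => [[z1 [ik' [gz hz]]]|[z1 [ik' [gz hz]]]|[ik' [gz hz]]];
  try (by case: (nk ik ik')); try (by case: (nk ik' ik)); try exact: lt_le_trans gx hz.
- case: ky => [[y1 _]|[_ [_ [gy hy]]]|[/(nk ik)[]]].
    exact: (cLtr i y x z).
  by case: (no _ _ yz gy hz).
- case: ky => [[_ [_ [gy hy]]]|[_ [_ [gy hy]]]|[/(nk ik)[]]].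
    by case: (no _ _ xy gx hy).
  by case: (no _ _ yz gy hz).
- case: ky => [[_ [_ [gy hy]]]|[y1 _]|[/(nk ik)[]]].
    by case: (no _ _ xy gx hy).
  exact: (cRtr i y x z).
Qed.

(** A middle point with [h y <= g y] gives [g x < h y <= g y < h z], so all such points can share
    one extra colour; the others are intervals. *)
Lemma threshold_coloring g h (k : nat) V : size V < 2 ^ k ->
  exists2 c : T -> nat, {in V, forall x, c x < k.+1} &
    forall i, {in [seq x <- V | c x == i] & &,
                 transitive (fun x y => (g x < h y)%O)}.
Proof.
move=> ltV; pose V' := [seq x <- V | (g x < h x)%O].
have [||c ck ctr] := @interval_coloring g h k V'.
- by apply: leq_ltn_trans ltV; rewrite size_filter count_size.
- by move=> x; rewrite mem_filter => /andP[].
exists (fun x => if (g x < h x)%O then c x else k) => [x xV|i y x z].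
  by case: ifP => // gh; apply: ltnW; apply: ck; rewrite mem_filter gh.
have key w :
  w \in [seq x <- V | (if (g x < h x)%O then c x else k) == i] ->
  w \in [seq x <- V' | c x == i] /\ i < k \/ i = k /\ (h w <= g w)%O.
  rewrite !mem_filter => /andP[/eqP cw wV]; move: cw.
  case: ltP => gh e; [left | by right].
  by rewrite e eqxx; split=> //; rewrite -e; apply: ck; rewrite mem_filter gh.
move=> /key ky /key kx /key kz xy yz.
case: ky => [[y1 ik]|[ik hg]]; last exact: lt_trans xy (le_lt_trans hg yz).
case: kx => [[x1 _]|[]]; last by lia.
case: kz => [[z1 _]|[]]; last by lia.
exact: (ctr i y x z).
Qed.

(** Each relation in turn passes to a large colour class. Transitivity survives in subsets, so every
    relation costs one factor [k.+1]. *)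
Lemma transitive_subset (I : eqType) (r : seq I) (g h : I -> T -> D) k V :
  uniq V -> size V < 2 ^ k ->
  exists S, [/\ uniq S, {subset S <= V}, size V <= size S * k.+1 ^ size r &
    {in r, forall i, {in S & &, transitive (fun x y => (g i x < h i y)%O)}}].
Proof.
move=> uV ltV; elim: r => [|i r [S [uS SV szS trS]]].
  by exists V; split=> //; rewrite muln1.
have ltS : size S < 2 ^ k.
  by apply: leq_ltn_trans ltV; apply: uniq_leq_size.
have [c ck ctr] := threshold_coloring (g i) (h i) ltS.
have [a Ha] := pigeonhole_filter ck.
exists [seq x <- S | c x == a]; split.
- exact: filter_uniq.
- by move=> x; rewrite mem_filter => /andP[_ /SV].
- apply: leq_trans szS _; rewrite /= expnS mulnA leq_mul2r.
  by apply/orP; right; rewrite mulnC.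
- move=> j; rewrite inE => /orP[/eqP->|jr]; first exact: ctr.
  move=> y x z; rewrite !mem_filter => /andP[_ yS] /andP[_ xS] /andP[_ zS].
  exact: trS.
Qed.

End Coloring.

(** * Chains and antichains of transitive relations *)

(** Induction applies to the points with a predecessor in [S]: a chain among them extends below its
    first element; otherwise the larger of their antichain and the set of minimal points
    suffices. *)
Lemma mirsky (T : eqType) (lt : rel T) (n : nat) (S : seq T) :
  irreflexive lt -> transitive lt -> uniq S ->
  (exists c, [/\ sorted lt c, {subset c <= S} & size c = n.+1]) \/
  (exists A, [/\ uniq A, {subset A <= S}, {in A &, forall x y, ~~ lt x y} &
                 size S <= n * size A]).
Proof.
move=> irr tr; elim: n S => [|n IH] S uS.
  case: S uS => [|x S] _; first by right; exists [::].
  by left; exists [:: x]; split=> // y; rewrite !inE => ->.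
pose m x := has (lt^~ x) S.
have szS : size S = size [seq x <- S | m x] + size [seq x <- S | ~~ m x].
  by rewrite !size_filter -(count_predC m S).
have [|[c [sc cS szc]]|[A [uA AS aA szA]]] := IH [seq x <- S | m x].
- exact: filter_uniq.
- left; case: c sc cS szc => [//|x c] sc cS szc.
  have /cS : x \in x :: c by rewrite mem_head.
  rewrite mem_filter => /andP[/hasP[y yS ltyx] xS].
  exists (y :: x :: c); split; rewrite /= ?ltyx //=; last by rewrite -szc.
  by move=> z; rewrite inE => /orP[/eqP->//|/cS]; rewrite mem_filter => /andP[].
- right; have [le|gt] := leqP (size [seq x <- S | ~~ m x]) (size A).
    exists A; split=> //; last by nia.
    by move=> x /AS; rewrite mem_filter => /andP[].
  exists [seq x <- S | ~~ m x]; split.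
  + exact: filter_uniq.
  + by move=> x; rewrite mem_filter => /andP[].
  + move=> x y; rewrite !mem_filter => /andP[_ xS] /andP[/hasPn ym _].
    exact: ym.
  + by nia.
Qed.

(* A transitive relation need not be antisymmetric; ties are broken by the
   position in S to get a strict order with the same comparable pairs. *)
Lemma transitive_ramsey (T : eqType) (E : rel T) (n : nat) (S : seq T) :
  uniq S -> {in S & &, transitive E} ->
  (exists c, [/\ uniq c, {subset c <= S}, size c = n.+1 &
     {in c &, forall x y, x != y -> E x y || E y x}]) \/
  (exists A, [/\ uniq A, {subset A <= S},
     {in A &, forall x y, x != y -> ~~ E x y} & size S <= n * size A]).
Proof.
move=> uS tE.
(* [E] is transitive only on [S], while [mirsky] asks for transitivity on the whole type; hence the
   membership clauses. *)
pose lt x y := [&& x \in S, y \in S, E x y & E y x ==> (index x S < index y S)].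
have irr : irreflexive lt.
  by move=> x; rewrite /lt ltnn; case: (E x x); rewrite ?andbF.
have tr : transitive lt.
  move=> y x z /and4P[xS yS xy ixy] /and4P[_ zS yz iyz].
  rewrite /lt xS zS (tE y x z) //=; apply/implyP => zx.
  have /(implyP ixy) : E y x by apply: (tE z).
  have /(implyP iyz) : E z y by apply: (tE x).
  by move=> lyz lxy; apply: ltn_trans lxy lyz.
have [[c [sc cS szc]]|[A [uA AS aA szA]]] := mirsky n irr tr uS; [left|right].
  exists c; split=> //; first exact: sorted_uniq sc.
  have pw : pairwise lt c by rewrite -sorted_pairwise.
  move=> x y /(nthP x)[i ilt <-] /(nthP x)[j jlt <-].
  have lp a b : a < b -> b < size c -> E (nth x c a) (nth x c b).
    move=> ab bs; have /(pairwiseP x) := pw.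
    by move=> /(_ a b); rewrite !inE => /(_ (ltn_trans ab bs) bs ab) /and4P[].
  case: (ltngtP i j) => [ij|ji|->]; last by rewrite eqxx.
    by move=> _; rewrite lp.
  by move=> _; rewrite (lp j i) ?orbT.
exists A; split=> // x y xA yA neq; apply/negP => xy.
have xS := AS x xA; have yS := AS y yA.
have /negP[] := aA x y xA yA; rewrite /lt xS yS xy /=; apply/implyP => yx.
(* When [E] holds both ways, only equal positions, that is [x = y], leave neither [lt x y] nor
   [lt y x]. *)
have := aA y x yA xA; rewrite /lt xS yS xy yx /= -leqNgt leq_eqVlt.
move=> /orP[/eqP e|//].
by case/eqP: neq; rewrite -(nth_index x xS) e nth_index.
Qed.

(** Each relation is applied to the antichain left by the previous ones, so the losses [n]
    multiply. *)
Lemma multi_transitive_ramsey (T I : eqType) (r : seq I) (E : I -> rel T)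
    (n : nat) (S : seq T) :
  uniq S -> {in r, forall i, {in S & &, transitive (E i)}} ->
  (exists c, [/\ uniq c, {subset c <= S}, size c = n.+1 &
     exists2 i, i \in r & {in c &, forall x y, x != y -> E i x y || E i y x}]) \/
  (exists A, [/\ uniq A, {subset A <= S}, size S <= n ^ size r * size A &
     {in r, forall i, {in A &, forall x y, x != y -> ~~ E i x y}}]).
Proof.
elim: r S => [|i r IH] S uS tE.
  by right; exists S; split=> //; rewrite mul1n.
have [|[c [uc cS szc cE]]|[A [uA AS aA szA]]] := transitive_ramsey n uS (E := E i).
- by apply: tE; rewrite mem_head.
- by left; exists c; split=> //; exists i; rewrite ?mem_head.
have [|[c [uc cS szc [j jr cE]]]|[B [uB BA szB aB]]] := IH A uA.
- move=> j jr y x z yA xA zA; apply: tE; rewrite ?inE ?jr ?orbT //; exact: AS.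
- left; exists c; split=> //; first by move=> x /cS /AS.
  by exists j => //; rewrite inE jr orbT.
right; exists B; split=> //; first by move=> x /BA /AS.
  by rewrite /= expnS -mulnA (leq_trans szA) // leq_mul2l szB orbT.
move=> j; rewrite inE => /orP[/eqP->|jr]; last exact: aB.
by move=> x y xB yB; apply: aA; apply: BA.
Qed.

(** * Polynomial bound for semilinear graphs *)

(** As [a.+1 <= 2 ^ a], [q.+1] is at most [2 * m * 2 ^ (q %/ (2 * m))]; the [m]-th power uses only
    half of the exponent [q]. *)
Lemma polynomial_le_exp2 (m q : nat) : 0 < m ->
  q.+1 ^ m <= (2 * m) ^ m * 2 ^ (q./2).
Proof.
move=> m0; have lt1 := ltn_ceil q (_ : 0 < 2 * m).
have lt2 : q.+1 <= 2 * m * 2 ^ (q %/ (2 * m)).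
  apply: leq_trans (lt1 _) _; first by lia.
  by rewrite mulnC leq_mul2l ltn_expl // orbT.
apply: leq_trans (_ : (2 * m * 2 ^ (q %/ (2 * m))) ^ m <= _).
  by rewrite leq_exp2r.
rewrite expnMn leq_mul2l -expnM leq_exp2l //; apply/orP; right.
have := leq_divM q (2 * m); lia.
Qed.

Local Open Scope ring_scope.

Lemma eval_lin_lt0 (d : nat) (f : linfun2 d) (x y : point d) :
  (eval_lin f x y < 0) =
  (f.2 + \sum_(k < d) f.1.1 ord0 k * x ord0 k <
   - \sum_(k < d) f.1.2 ord0 k * y ord0 k).
Proof. by rewrite /eval_lin -subr_gt0 -[in RHS]subr_gt0 sub0r opprD addrC. Qed.

(** A loss of [k.+1] for each of the [u * t] conditions leaves [n ^ u.+1] points; a loss of [n] for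
    each of the [u] conjunctions leaves [n]. *)
Lemma ramsey_of_size (t u n N k : nat) : (0 < n)%N -> (N < 2 ^ k)%N ->
  (n ^ u.+1 * k.+1 ^ (u * t) <= N)%N -> ramsey_prop t u n N.
Proof.
move=> n0 Nk leN d _ V uV szV F symF.
pose g (p : 'I_u * 'I_t) (x : point d) : R :=
  (F p.1 p.2).2 + \sum_(k < d) (F p.1 p.2).1.1 ord0 k * x ord0 k.
pose h (p : 'I_u * 'I_t) (y : point d) : R :=
  - \sum_(k < d) (F p.1 p.2).1.2 ord0 k * y ord0 k.
have [|S [uS SV szS trS]] :=
  transitive_subset (enum {: 'I_u * 'I_t}) g h uV (k := k).
  by rewrite szV.
pose E (i : 'I_u) (x y : point d) := [forall j, g (i, j) x < h (i, j) y].
have adjE x y : sl_adj F x y <-> exists i, E i x y.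
  split=> -[i Ei]; exists i.
    by apply/forallP => j; rewrite -eval_lin_lt0.
  by move=> j; rewrite eval_lin_lt0; apply: (forallP Ei).
have trE : {in enum 'I_u, forall i, {in S & &, transitive (E i)}}.
  move=> i _ y x z yS xS zS /forallP xy /forallP yz; apply/forallP => j.
  by apply: (trS (i, j) _ y) => //; rewrite mem_enum.
have leS : (n ^ u.+1 <= size S)%N.
  rewrite -(@leq_pmul2r (k.+1 ^ (u * t))) ?expn_gt0 //.
  apply: leq_trans leN _; rewrite -szV; apply: leq_trans szS _.
  by rewrite -cardT card_prod !card_ord.
have [[c [uc cS szc [i _ cE]]]|[A [uA AS szA aA]]] :=
  multi_transitive_ramsey n uS trE.
  have tc : {subset take n c <= c} by move=> x; apply: mem_take.
  exists (take n c); split; first exact: take_uniq.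
  - by move=> x /tc /cS /SV.
  - by rewrite size_takel // szc.
  - left=> x y /tc xc /tc yc /eqP neq; have [xS yS] := (cS x xc, cS y yc).
    have [Exy|Eyx] := orP (cE x y xc yc neq); first by apply/adjE; exists i.
    (* Only [E i y x] is known here; symmetry of adjacency reverses it. *)
    apply/(symF x y (SV x xS) (SV y yS)); first exact/eqP.
    by apply/adjE; exists i.
have tA : {subset take n A <= A} by move=> x; apply: mem_take.
have leA : (n <= size A)%N.
  rewrite -(@leq_pmul2l (n ^ u)) ?expn_gt0 ?n0 // -expnSr.
  by apply: leq_trans leS _; rewrite -cardT card_ord in szA.
exists (take n A); split; first exact: take_uniq.
- by move=> x /tA /AS /SV.
- by rewrite size_takel.
- right=> x y /tA xA /tA yA /eqP neq /adjE[i Exy].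
  by have /negP[] := aA i (mem_enum _ i) x y xA yA neq.
Qed.

Local Open Scope nat_scope.

Lemma ramsey_polynomial (u t : nat) : 0 < u -> 0 < t ->
  exists2 C, 0 < C & forall n, 0 < n ->
  exists2 N, N <= C * n ^ u.+2 & ramsey_prop t u n N.
Proof.
move=> u0 t0; pose m := u * t; have m0 : 0 < m by rewrite muln_gt0 u0.
(* The factor [u.+2] comes from [k.+1 <= u.+2 * q.+1] below, the factor [2 * m] from
   [polynomial_le_exp2]. *)
pose c := (u.+2 * (2 * m)) ^ m.
exists (2 * 2 ^ c.*2) => [|n n0]; first by rewrite muln_gt0 expn_gt0.
have [nL Ln] := andP (trunc_log_bounds (erefl : 1 < 2) n0).
set L := (trunc_log 2 n).+1 in Ln; have {nL} Ln2 : 2 ^ L <= 2 * n.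
  by rewrite expnS leq_mul2l.
(* N < 2 ^ k for a k linear in L, so the polylogarithmic loss k.+1 ^ m is
   absorbed by the factor 2 ^ (c.*2 + L), linear in n. *)
exists (n ^ u.+1 * 2 ^ (c.*2 + L)).
  rewrite expnD [n ^ u.+2]expnSr.
  have -> : 2 * 2 ^ c.*2 * (n ^ u.+1 * n) = n ^ u.+1 * 2 ^ c.*2 * (2 * n) by ring.
  by rewrite mulnA leq_mul2l Ln2 orbT.
(* This [k] works because [n < 2 ^ L] gives [n ^ u.+1 < 2 ^ (L * u.+1)]. *)
apply: (@ramsey_of_size _ _ _ _ (L * u.+1 + (c.*2 + L))) => //.
  by rewrite [in ltnRHS]expnD ltn_pmul2r ?expn_gt0 // expnM ltn_exp2r.
rewrite leq_mul2l; apply/orP; right; rewrite -/m.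
pose q := c.*2 + L.
apply: leq_trans (_ : (u.+2 * q.+1) ^ m <= _).
  by rewrite leq_exp2r // /q; nia.
rewrite expnMn; apply: leq_trans (leq_mul (leqnn _) (polynomial_le_exp2 q m0)) _.
rewrite mulnA -expnMn -/c.
(* Here [c < 2 ^ c], and [c + q./2 <= q] because [q] contains [c] twice. *)
apply: leq_trans (_ : 2 ^ c * 2 ^ q./2 <= _).
  by rewrite leq_mul2r ltnW ?orbT // ltn_expl.
by rewrite -expnD leq_exp2l // /q; lia.
Qed.

Open Scope R_scope.

Theorem theorem1p5 :
  forall u : nat, (0 < u)%N ->
  exists beta : R, 0 < beta /\
  forall t : nat, (0 < t)%N ->
  exists alpha : R, 0 < alpha /\
  forall n : nat, (0 < n)%N ->
  R_tu_le t u n (alpha * Rpower (INR n) beta).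
Proof.
(* The exponent is fixed before [t]; only [C] depends on [t]. *)
move=> u u0; exists (INR u.+2%N); split; first exact: lt_0_INR (Nat.lt_0_succ _).
move=> t t0; have [C C0 HC] := ramsey_polynomial u0 t0.
exists (INR C); split; first by apply: lt_0_INR; apply/ssrnat.ltP.
move=> n n0; have [N leN HN] := HC n n0; exists N; split=> //.
rewrite Rpower_pow; last by apply: lt_0_INR; apply/ssrnat.ltP.
have -> : INR n ^ u.+2%N = INR (n ^ u.+2)%N.
  elim: u.+2%N => [|k IH]; first by rewrite expn0.
  by rewrite expnS -multE mult_INR -IH.
rewrite -mult_INR; apply: le_INR; exact/ssrnat.leP.
Qed.
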